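(* Let $n\ge 2$ and let $\mathscr{C}_H\subseteq\mathbb{F}_2^{2^n-1}$ be the $[2^n-1,\,2^n-1-n,\,3]$ Hamming code. Let $G_3=(\mathcal{V},\mathcal{E})$ be the graph with vertex set $\mathcal{V}=\mathscr{C}_H$ and edge set $\mathcal{E}=\{(\mathbf{c}_i,\mathbf{c}_j)\mid \mathbf{c}_i,\mathbf{c}_j\in\mathscr{C}_H,\ d_H(\mathbf{c}_i,\mathbf{c}_j)=3\}$. Then $G_3$ is bipartite with bipartition $\mathscr{C}_H=\mathcal{C}_e\cup\mathcal{C}_o$, where $\mathcal{C}_e$ and $\mathcal{C}_o$ denote the subsets of codewords of $\mathscr{C}_H$ with even and odd Hamming weight, respectively.
   Context: The $[2^n-1,\,2^n-1-n,\,3]$ Hamming code is the kernel over $\mathbb{F}_2$ of an $n\times(2^n-1)$ matrix $H$ whose columns are all the nonzero vectors of $\mathbb{F}_2^n$, each appearing once. $\mathrm{wt}$ denotes Hamming weight and $d_H$ Hamming distance. Edges are unordered. *)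

(* Defs.v *)
From HB Require Import structures.
From mathcomp Require Import all_boot all_order all_algebra.
Set Implicit Arguments.
Unset Strict Implicit.
Unset Printing Implicit Defensive.
Import GRing.Theory.
Local Open Scope ring_scope.

Definition hamming_weight (N : nat) (x : 'rV['F_2]_N) : nat :=
  #|[set i : 'I_N | x 0 i != 0]|.

Definition hamming_dist (N : nat) (x y : 'rV['F_2]_N) : nat :=
  #|[set i : 'I_N | x 0 i != y 0 i]|.

Lemma hamming_distxx (N : nat) (x : 'rV['F_2]_N) : hamming_dist x x = 0%N.
Proof. by apply: eq_card0 => i; rewrite inE eqxx. Qed.

Definition hamming_check_matrix (n : nat) (H : 'M['F_2]_(n, 2 ^ n - 1)) : Prop :=
  (forall j, col j H != 0) /\
  (forall v : 'cV['F_2]_n, v != 0 -> exists! j, col j H = v).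

(* Codewords are row vectors, whence the transpose. *)
Definition code_of_check (n N : nat) (H : 'M['F_2]_(n, N)) : {set 'rV['F_2]_N} :=
  [set c | H *m c^T == 0].

Definition even_weight_part (N : nat) (C : {set 'rV['F_2]_N}) :
    {set 'rV['F_2]_N} :=
  [set c in C | ~~ odd (hamming_weight c)].

Definition odd_weight_part (N : nat) (C : {set 'rV['F_2]_N}) :
    {set 'rV['F_2]_N} :=
  [set c in C | odd (hamming_weight c)].

(* Finite simple graphs: an (unordered) edge is a two-element set of vertices. *)
Record graph (T : finType) := Graph {
  vertices : {set T};
  edges : {set {set T}};
  edges_wf : forall e, e \in edges -> e \subset vertices /\ #|e| = 2
}.

Definition is_bipartition (T : finType) (G : graph T) (A B : {set T}) : Prop :=
  [/\ vertices G = A :|: B,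
      [disjoint A & B] &
      forall e, e \in edges G ->
        exists a b, [/\ a \in A, b \in B & e = [set a; b]]].

Definition dist3_edges (N : nat) (C : {set 'rV['F_2]_N}) :
    {set {set 'rV['F_2]_N}} :=
  [set [set x; y] | x in C, y in C & hamming_dist x y == 3].

Lemma dist3_edges_wf (N : nat) (C : {set 'rV['F_2]_N}) e :
  e \in dist3_edges C -> e \subset C /\ #|e| = 2.
Proof.
case/imset2P => x y xC; rewrite inE => /andP[yC /eqP dxy] ->; split.
  by apply/subsetP => z; rewrite !inE => /orP[] /eqP ->.
rewrite cards2; case: eqP => // exy.
by move: dxy; rewrite exy hamming_distxx.
Qed.

Definition dist3_graph (N : nat) (C : {set 'rV['F_2]_N}) : graph 'rV['F_2]_N :=
  Graph (@dist3_edges_wf N C).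

(* Main.v *)
(* Over F_2 the supports of x and y have symmetric difference
   { i | x_i <> y_i }, so d(x, y) = wt(x) + wt(y) modulo 2; codewords at the odd
   distance 3 therefore have weights of opposite parity. *)
Require Import Defs.
From mathcomp Require Import all_boot all_order all_algebra.

(** Writing parity as an iterated exclusive or reduces the parity identity for distances to a check
    at each coordinate. *)
Lemma odd_card_bigaddb (T : finType) (P : pred T) :
  odd #|[set i | P i]| = \big[addb/false]_i P i.
Proof.
rewrite -sum1_card big_mkcond /= (big_morph odd oddD (erefl (odd 0))).
by apply: eq_bigr => i _; rewrite inE; case: (P i).
Qed.

(** Specific to two elements: any two nonzero entries coincide. *)
Lemma neq_F2 (a b : 'F_2) : (a != b) = (a != 0%R) (+) (b != 0%R).
Proof. by case: a b => [[|[|a]] ?] [[|[|b]] ?]. Qed.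

Lemma odd_hamming_dist (N : nat) (x y : 'rV['F_2]_N) :
  odd (hamming_dist x y) = odd (hamming_weight x) (+) odd (hamming_weight y).
Proof.
rewrite !odd_card_bigaddb -big_split /=.
by apply: eq_bigr => i _; apply: neq_F2.
Qed.

Lemma dist3_graph_bipartition (N : nat) (C : {set 'rV['F_2]_N}) :
  is_bipartition (dist3_graph C) (even_weight_part C) (odd_weight_part C).
Proof.
split=> [||e] /=.
- by apply/setP => c; rewrite !inE -andb_orr orNb andbT.
- rewrite -setI_eq0; apply/eqP/setP => c; rewrite !inE.
  by case: odd; rewrite /= ?andbF.
case/imset2P => x y xC; rewrite inE => /andP[yC /eqP dxy] ->.
have := odd_hamming_dist _ x y; rewrite dxy /=.
case wx: (odd (hamming_weight x)) => /= /esym wy.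
(* The even endpoint is the first witness, so an odd [x] forces a swap, harmless as edges are
   unordered. *)
- by exists y, x; rewrite !inE xC yC wx wy setUC.
- by exists x, y; rewrite !inE xC yC wx wy.
Qed.

Theorem proposition1 (n : nat) (hn : (2 <= n)%N)
    (H : 'M['F_2]_(n, 2 ^ n - 1)) (hH : hamming_check_matrix H) :
  is_bipartition (dist3_graph (code_of_check H))
    (even_weight_part (code_of_check H)) (odd_weight_part (code_of_check H)).
Proof. exact: dist3_graph_bipartition. Qed.
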